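(* Let $n\ge 2$ and let $K_n$ be the complete graph on $n$ vertices. Then $$\alpha(K_n)+\alpha(L(K_n))=\left\lfloor \frac{n}{2}\right\rfloor+1 \quad\text{and}\quad \alpha(K_n)\cdot\alpha(L(K_n))=\left\lfloor \frac{n}{2}\right\rfloor .$$
   Context: All graphs are simple, finite and have no isolated vertices. For a graph $G$, $\alpha(G)$ denotes its independence number, i.e. the maximum cardinality of a set of pairwise non-adjacent vertices of $G$. $L(G)$ denotes the line graph of $G$: its vertices are in one-to-one correspondence with the edges of $G$, and two vertices of $L(G)$ are adjacent if and only if the corresponding edges of $G$ are adjacent (share an endpoint). *)

(* Defs.v *)
From mathcomp Require Import all_boot.

Set Implicit Arguments.
Unset Strict Implicit.
Unset Printing Implicit Defensive.

(* Isolated vertices are allowed here: the line graph of K_2 is a single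
   vertex, so the class of graphs without them is not closed under L. *)
Record sgraph := SGraph {
  vertex :> finType;
  adj : rel vertex;
  adj_sym : symmetric adj;
  adj_irrefl : irreflexive adj
}.

Section Graph.
Variable G : sgraph.

(* As adj is irreflexive, quantifying over all pairs amounts to quantifying
   over pairs of distinct vertices. *)
Definition independent (S : {set G}) : bool :=
  [forall x in S, forall y in S, ~~ adj x y].

Definition alpha : nat := \max_(S : {set G} | independent S) #|S|.

Definition edges : {set {set G}} :=
  [set e | [exists x : G, exists y : G, adj x y && (e == [set x; y])]].

Definition edge : finType := {e : {set G} | e \in edges}.

Definition line_adj : rel edge :=
  fun e f => (e != f) && (val e :&: val f != set0).

Lemma line_adj_sym : symmetric line_adj.
Proof. by move=> e f; rewrite /line_adj eq_sym setIC. Qed.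

Lemma line_adj_irrefl : irreflexive line_adj.
Proof. by move=> e; rewrite /line_adj eqxx. Qed.

Definition line_graph : sgraph := SGraph line_adj_sym line_adj_irrefl.

End Graph.

Section Complete.
Variable n : nat.

Definition complete_adj : rel 'I_n := fun i j => i != j.

Lemma complete_adj_sym : symmetric complete_adj.
Proof. by move=> i j; rewrite /complete_adj eq_sym. Qed.

Lemma complete_adj_irrefl : irreflexive complete_adj.
Proof. by move=> i; rewrite /complete_adj eqxx. Qed.

Definition complete_graph : sgraph :=
  SGraph complete_adj_sym complete_adj_irrefl.

End Complete.

(* Main.v *)
Require Import Defs.
From mathcomp Require Import all_boot.

(** The independent sets of [L(G)] are the matchings of [G]: a matching covers
    twice as many vertices as it has edges, and in [K_n] the edges
    [{2i, 2i+1}] form a matching of size [n %/ 2]. *)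

(** Distinct vertices of K_n are always adjacent, so [alpha_complete_graph] gives the value 1 and
    both identities reduce to alpha(L(K_n)) = [n %/ 2]. The upper bound, [alpha_line_graph_leq],
    holds in every graph by counting covered vertices; [leq_alpha_line_complete_graph] matches it
    with the edges supplied by [consecutive_pair_edge]. *)

Lemma independentP (G : sgraph) (S : {set G}) :
  reflect {in S &, forall x y, ~~ adj x y} (independent S).
Proof.
apply: (iffP forall_inP) => [h x y xS yS|h x xS].
  exact: (forall_inP (h x xS)).
by apply/forall_inP => y yS; exact: h.
Qed.

Lemma leq_alpha (G : sgraph) (S : {set G}) : independent S -> #|S| <= alpha G.
Proof. exact: (@leq_bigmax_cond _ _ (fun S : {set G} => #|S|)). Qed.

Lemma alpha_leqP (G : sgraph) (m : nat) :
  reflect (forall S : {set G}, independent S -> #|S| <= m) (alpha G <= m).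
Proof. exact: bigmax_leqP. Qed.

Lemma card_edge (G : sgraph) (e : edge G) : #|val e| = 2.
Proof.
have := valP e; rewrite inE => /existsP[x /existsP[y /andP[xy /eqP ->]]].
rewrite cards2; case: eqVneq xy => // ->.
by rewrite adj_irrefl.
Qed.

(** Independent edges are pairwise disjoint 2-sets, so together they cover [2 * #|S|] vertices of
    [G]. *)
Lemma alpha_line_graph_leq (G : sgraph) : alpha (line_graph G) <= #|G| %/ 2.
Proof.
apply/alpha_leqP => S /independentP indS; rewrite leq_divRL //.
have tS : trivIset (val @: S).
  apply/trivIsetP => _ _ /imsetP[e eS ->] /imsetP[f fS ->] nef.
  have := indS e f eS fS; rewrite /= /line_adj -val_eqE nef negbK.
  by rewrite setI_eq0.
have cS : {in val @: S, forall B : {set G}, #|B| = 2}.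
  by move=> _ /imsetP[e _ ->]; exact: card_edge.
(* [#|S| * 2] becomes the sum of the block sizes, which by [tS] is the size of their union. *)
rewrite -(card_imset (mem S) val_inj) -sum_nat_const -(eq_bigr _ cS).
by rewrite (eqP tS) max_card.
Qed.

Lemma alpha_complete_graph (n : nat) : 0 < n -> alpha (complete_graph n) = 1.
Proof.
case: n => // n _; apply/eqP; rewrite eqn_leq; apply/andP; split.
  apply/alpha_leqP => S /independentP indS; apply/card_le1_eqP => x y xS yS.
  by have /= := indS x y xS yS; rewrite negbK => /eqP.
rewrite -(cards1 (ord0 : complete_graph n.+1)); apply/leq_alpha/independentP.
by move=> x y /set1P -> /set1P ->; rewrite adj_irrefl.
Qed.

(** Describing {2i, 2i+1} as the fibre of [x %/ 2] over [i] makes disjointness for different [i]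
    immediate. *)
Lemma consecutive_pair_edge (n : nat) (i : 'I_(n %/ 2)) :
  exists e : edge (complete_graph n), forall x : 'I_n,
    (x \in val e) = (x %/ 2 == i).
Proof.
(* From i + 1 <= [n %/ 2] follows 2i + 2 <= n, so both endpoints exist. *)
have ltn : i * 2 + 1 < n.
  rewrite addn1 (leq_trans _ (leq_divM n 2)) //.
  by rewrite -[(i * 2).+2]/(i.+1 * 2) leq_mul2r ltn_ord.
have ltn0 : i * 2 < n by rewrite (leq_trans _ ltn) // addn1 ltnS.
pose a : complete_graph n := Ordinal ltn0.
pose b : complete_graph n := Ordinal ltn.
have abE : [set a; b] \in edges (complete_graph n).
  rewrite inE; apply/existsP; exists a; apply/existsP; exists b.
  by rewrite eqxx andbT /= /complete_adj -val_eqE /= addn1 neq_ltn ltnSn.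
exists (exist (fun e : {set complete_graph n} => e \in edges _) _ abE) => x.
rewrite /= !inE -!val_eqE /=.
apply/orP/eqP => [[/eqP ->|/eqP ->]|<-]; first by rewrite mulnK.
  by rewrite divnMDl ?addn0.
(* The remainder of [x] modulo 2 selects the endpoint. *)
have := divn_eq x 2; have := ltn_pmod x (isT : 0 < 2).
by case: (x %% 2) => [|[|//]] _ {1 3}->; [left; rewrite addn0|right].
Qed.

Lemma leq_alpha_line_complete_graph (n : nat) :
  n %/ 2 <= alpha (line_graph (complete_graph n)).
Proof.
have [f fE] := fin_all_exists (@consecutive_pair_edge n).
have f_disj i j x : x \in val (f i) -> x \in val (f j) -> i = j.
  by rewrite !fE => /eqP xi /eqP xj; apply/val_inj; rewrite /= -xi -xj.
have f_inj : injective f.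
  (* An edge is nonempty, and any vertex of it determines its index. *)
  move=> i j fij; have /card_gt0P[x xi] : 0 < #|val (f i)| by rewrite card_edge.
  by apply: (f_disj _ _ x); rewrite -?fij.
rewrite -[n %/ 2]card_ord -cardsT -(card_imset _ f_inj).
apply/(@leq_alpha (line_graph _))/independentP => _ _ /imsetP[i _ ->] /imsetP[j _ ->].
rewrite /= /line_adj negb_and !negbK; case: (eqVneq (f i) (f j)) => //= nij.
apply/eqP/setP => x; rewrite in_setI in_set0; apply/negbTE/andP => -[xi xj].
by rewrite (f_disj i j x xi xj) eqxx in nij.
Qed.

Theorem proposition2p3 (n : nat) (hn : 2 <= n) :
  alpha (complete_graph n) + alpha (line_graph (complete_graph n)) = n %/ 2 + 1
  /\ alpha (complete_graph n) * alpha (line_graph (complete_graph n)) = n %/ 2.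
Proof.
have -> : alpha (line_graph (complete_graph n)) = n %/ 2.
  apply/eqP; rewrite eqn_leq leq_alpha_line_complete_graph andbT.
  by have := alpha_line_graph_leq (complete_graph n); rewrite card_ord.
by rewrite alpha_complete_graph ?mul1n 1?addnC // (leq_trans _ hn).
Qed.
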